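(* Given the elasticity operator $\mathcal{A}_\gamma(\boldsymbol{w})$ and its discrete counterpart $A_\gamma(\boldsymbol{w}_h)$, the discrete operator $$S_{\alpha\gamma}(\boldsymbol{h}_h)A_\gamma(\boldsymbol{w}_h):=M_{\gamma1}^{\mathrm T}(\boldsymbol{h}_h)\,M_{\gamma3}^{-1}A_\gamma(\boldsymbol{w}_h)$$ satisfies the following semi-discrete energy estimate whenever the discrete velocity coupling $M_{\gamma3}\boldsymbol{w}_h'-M_{\gamma1}(\boldsymbol{w}_h)\boldsymbol{u}_h=\boldsymbol{0}$ is satisfied: $$\bigl(S_{\alpha\gamma}(\boldsymbol{w}_h)A_\gamma(\boldsymbol{w}_h)\bigr)\cdot\boldsymbol{u}_h=\frac{d}{dt}\int_B\hat W^e_{\mathrm s}(\mathsf{F}[\boldsymbol{w}_h])\,dV.$$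
   Context: $d\in\{2,3\}$; $\Omega\subset\mathbb{R}^d$ is a fixed domain and $B\subset\mathbb{R}^d$ is the reference configuration of a solid. $\mathscr{V}=\{\boldsymbol{u}\in H^1(\Omega)^d:\boldsymbol{u}|_{\partial\Omega_D}=\boldsymbol{u}_g\}$ with $\partial\Omega_D\subseteq\partial\Omega$; $\mathscr{Y}=\{\boldsymbol{w}\in L^2(B)^d:\nabla_{\boldsymbol{s}}\boldsymbol{w}\in L^\infty(B)^{d\times d}\}$; $\mathscr{H}_Y=H^1(B)^d$. $\mathscr{V}_h=\mathrm{span}\{\boldsymbol{v}_h^j\}_{j=1}^{N_V}\subset\mathscr{V}$ and $\mathscr{Y}_h=\mathrm{span}\{\boldsymbol{y}_h^i\}_{i=1}^{N_Y}\subset\mathscr{Y}$ are finite element spaces (given by bases) of continuous, piecewise polynomial fields on $\Omega$ and $B$. Elements of these spaces are identified with their time-dependent coefficient column vectors, e.g. $\boldsymbol{u}_h=\sum_ju_h^j(t)\boldsymbol{v}_h^j$, $\boldsymbol{w}_h=\sum_iw_h^i(t)\boldsymbol{y}_h^i$, $\boldsymbol{w}_h'=\sum_i(w_h^i)'(t)\boldsymbol{y}_h^i$; the dot in $(\,\cdot\,)\cdot\boldsymbol{u}_h$ is the scalar product in $\mathbb{R}^{N_V}$. For a displacement $\boldsymbol{w}$: $\mathsf{F}[\boldsymbol{w}]=\mathsf{I}+\nabla_{\boldsymbol{s}}\boldsymbol{w}$, with $\det\mathsf{F}[\boldsymbol{w}]\ge J_m>0$ and $\boldsymbol{s}+\boldsymbol{w}(\boldsymbol{s})\in\Omega$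 for $\boldsymbol{s}\in B$. $\hat W^e_{\mathrm s}(\mathsf F)$ is the elastic strain energy density, a $C^1$ convex function on tensors with positive determinant, and $\hat{\mathsf P}^e_{\mathrm s}[\boldsymbol{w}]=\partial\hat W^e_{\mathrm s}/\partial\mathsf F$ at $\mathsf F[\boldsymbol{w}]$. The operator $\mathcal{A}_\gamma(\boldsymbol{w})\in\mathscr{H}_Y^*$ is $\langle\mathcal{A}_\gamma(\boldsymbol{w}),\boldsymbol{y}\rangle=\int_B\hat{\mathsf P}^e_{\mathrm s}[\boldsymbol{w}]\cdot\nabla_{\boldsymbol{s}}\boldsymbol{y}\,dV$, and its discrete counterpart is the vector $A_\gamma(\boldsymbol{w}_h)\in\mathbb{R}^{N_Y}$, $A_\gamma(\boldsymbol{w}_h)^i=\langle\mathcal{A}_\gamma(\boldsymbol{w}_h),\boldsymbol{y}_h^i\rangle$. With a constant $\Phi_B>0$, the matrices are $$M_{\gamma3}^{ij}=\Phi_B\int_B\boldsymbol{y}_h^j\cdot\boldsymbol{y}_h^i\,dV\ (N_Y\times N_Y),\qquad M_{\gamma1}^{ij}(\boldsymbol{h}_h)=\Phi_B\int_B\boldsymbol{v}_h^j(\boldsymbol{s}+\boldsymbol{h}_h(\boldsymbol{s}))\cdot\boldsymbol{y}_h^i(\boldsymbol{s})\,dV\ (N_Y\times N_V).$$ *)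

(* Defs.v *)
From HB Require Import structures.
From mathcomp Require Import all_boot all_order all_algebra.
From mathcomp Require Import all_classical all_reals all_analysis.
From mathcomp Require mpoly.

Set Implicit Arguments.
Unset Strict Implicit.
Unset Printing Implicit Defensive.
Import Order.TTheory GRing.Theory Num.Theory.
Import numFieldNormedType.Exports.

Local Open Scope classical_set_scope.
Local Open Scope ring_scope.

(* The sigma-algebra on matrices generated by the entries; over the reals it is
   the Borel sigma-algebra. *)
Definition measure_matrix_display : measure_display -> measure_display.
Proof. exact. Qed.

Section measurable_matrix.
Context {d} {T : measurableType d}.
Variables m n : nat.

Definition mx_entry_sets : set (set 'M[T]_(m, n)) :=
  \bigcup_(k in [set: 'I_m * 'I_n])
    preimage_set_system setT (fun M : 'M[T]_(m, n) => M k.1 k.2) measurable.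

Let mx_set0 : <<s mx_entry_sets >> set0.
Proof. exact: sigma_algebra0. Qed.

Let mx_setC A : <<s mx_entry_sets >> A -> <<s mx_entry_sets >> (~` A).
Proof. exact: sigma_algebraC. Qed.

Let mx_bigcup (F : (set 'M[T]_(m, n))^nat) :
  (forall i, <<s mx_entry_sets >> (F i)) ->
  <<s mx_entry_sets >> (\bigcup_i (F i)).
Proof. exact: sigma_algebra_bigcup. Qed.

HB.instance Definition _ := @isMeasurable.Build (measure_matrix_display d)
  'M[T]_(m, n) <<s mx_entry_sets >> mx_set0 mx_setC mx_bigcup.

End measurable_matrix.

Lemma measurable_mx_entry d (T : measurableType d) m n (i : 'I_m) (j : 'I_n) :
  measurable_fun [set: 'M[T]_(m, n)] (fun M => M i j).
Proof.
move=> _ Y mY; apply: sub_sigma_algebra.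
by exists (i, j) => //; exists Y.
Qed.

Lemma measurable_fun_mxP d d' (S : measurableType d') (T : measurableType d)
    m n (f : S -> 'M[T]_(m, n)) :
  (forall i j, measurable_fun setT (fun x => f x i j)) <->
  measurable_fun setT f.
Proof.
split=> [fij|mf i j]; last first.
  exact: (measurableT_comp (measurable_mx_entry i j)).
have H := @measurability _ _ _ _ setT f (mx_entry_sets (T := T) (m := m) (n := n)).
apply: H => // _ [_ [[i j] _ [C mC <-]] <-].
by rewrite !setTI -comp_preimage -[X in measurable X]setTI; exact: fij.
Qed.

Section lebesgue_rV.
Variable R : realType.

Definition rV_cons n (p : measurableTypeR R * 'rV[R]_n) : 'rV[R]_n.+1 :=
  row_mx (p.1 : R)%:M p.2.

Lemma measurable_rV_cons n : measurable_fun setT (@rV_cons n).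
Proof.
apply/measurable_fun_mxP => i k; case: (@split_ordP 1 n k) => j ->.
  rewrite (_ : (fun _ => _) = fst) //; apply/funext => p.
  by rewrite [LHS]row_mxEl !ord1 mxE eqxx mulr1n.
rewrite (_ : (fun _ => _) = (fun M : 'rV[R]_n => M i j) \o snd); last first.
  by apply/funext => p; exact: row_mxEr.
exact: (measurableT_comp (measurable_mx_entry i j) measurable_snd).
Qed.

Lemma measurable_rV_head n :
  measurable_fun setT (fun v : 'rV[R]_n.+1 => v ord0 ord0).
Proof. exact: measurable_mx_entry. Qed.

Lemma measurable_rV_behead n :
  measurable_fun setT (fun v : 'rV[R]_n.+1 => rsubmx (v : 'rV_(1 + n))).
Proof.
apply/measurable_fun_mxP => i j.
rewrite (_ : (fun _ => _) = fun v : 'rV[R]_n.+1 => v i (rshift 1 j)).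
  exact: measurable_mx_entry.
by apply/funext => v; rewrite mxE.
Qed.

Section step.
Variables (n : nat) (mu : {sigma_finite_measure set 'rV[R]_n -> \bar R}).

Definition lebesgue_rV_step : set 'rV[R]_n.+1 -> \bar R :=
  pushforward (@lebesgue_measure R \x mu)%E (@rV_cons n).

HB.instance Definition _ := Measure.copy lebesgue_rV_step
  (measure_function_pushforward__canonical__measure_function_Measure
     (@lebesgue_measure R \x mu)%E (@measurable_rV_cons n)).

Let step_sigma_finite : sigma_finite setT lebesgue_rV_step.
Proof.
pose g (v : 'rV[R]_n.+1) : measurableTypeR R * 'rV[R]_n :=
  (v ord0 ord0, rsubmx (v : 'rV_(1 + n))).
have gK : cancel (@rV_cons n) g.
  move=> [x v]; rewrite /g /rV_cons row_mxKr; congr pair.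
  rewrite (_ : ord0 = lshift n (ord0 : 'I_1)); last exact: val_inj.
  by rewrite [LHS]row_mxEl mxE eqxx mulr1n.
have mg : measurable_fun setT g.
  by apply/measurable_fun_pairP; split;
    [exact: measurable_rV_head|exact: measurable_rV_behead].
have /sigma_finiteP[F [FT ndF Foo]] := sigma_finiteT (@lebesgue_measure R).
have /sigma_finiteP[G [GT ndG Goo]] := sigma_finiteT mu.
exists (fun k => g @^-1` (F k `*` G k)).
  apply/esym; rewrite -subTset => v _.
  have [k _ Fk] : (\bigcup_i F i) (g v).1 by rewrite -FT.
  have [l _ Gl] : (\bigcup_i G i) (g v).2 by rewrite -GT.
  exists (maxn k l) => //; split.
  - by move: Fk; exact/subsetPset/ndF/leq_maxl.
  - by move: Gl; exact/subsetPset/ndG/leq_maxr.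
move=> k; have [mF Fk] := Foo k; have [mG Gk] := Goo k; split.
  by rewrite -[X in measurable X]setTI; apply: mg => //; exact: measurableX.
rewrite /lebesgue_rV_step /pushforward -comp_preimage.
rewrite (_ : g \o _ = id); last by apply/funext => p; rewrite /= gK.
by rewrite preimage_id product_measure1E// lte_mul_pinfty// ge0_fin_numE.
Qed.

HB.instance Definition _ := Measure_isSigmaFinite.Build _ _ _
  lebesgue_rV_step step_sigma_finite.
End step.

Fixpoint lebesgue_rV n : {sigma_finite_measure set 'rV[R]_n -> \bar R} :=
  match n with
  | 0 => \d_(0 : 'rV[R]_0)
  | n'.+1 => lebesgue_rV_step (lebesgue_rV n')
  end.

Lemma lebesgue_rV_box n (A : 'I_n -> set R) :
  (forall i, measurable (A i)) ->
  lebesgue_rV n [set v | forall i, A i (v ord0 i)] =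
  (\prod_(i < n) lebesgue_measure (A i))%E.
Proof.
elim: n A => [|n IHn] A mA /=.
  by rewrite big_ord0 diracE mem_set//= => -[].
rewrite big_ord_recl -IHn//.
have mB : measurable [set v : 'rV[R]_n | forall i, A (lift ord0 i) (v ord0 i)].
  rewrite (_ : [set _ | _] = \bigcap_(i in [set: 'I_n])
      ((fun v : 'rV[R]_n => v ord0 i) @^-1` A (lift ord0 i))); last first.
    by apply/seteqP; split=> v vA i; [move=> _|]; exact: vA.
  apply: fin_bigcap_measurable => // i _.
  by rewrite -[X in measurable X]setTI; exact: measurable_mx_entry.
rewrite /lebesgue_rV_step /pushforward -[RHS]product_measure1E//;
  last exact: (mA ord0).
congr product_measure1; apply/seteqP; split=> [[x v] /= H|[x v] /= [H1 H2] i].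
  split=> [|i].
    have := H ord0; rewrite /rV_cons (_ : ord0 = lshift n (ord0 : 'I_1));
      last exact: val_inj.
    by rewrite [X in A _ X -> _]row_mxEl mxE eqxx mulr1n.
  have := H (lift ord0 i); rewrite /rV_cons.
  rewrite (_ : lift ord0 i = rshift 1 i :> 'I_(1 + n)); last exact: val_inj.
  by rewrite [X in A _ X -> _]row_mxEr.
case: (unliftP ord0 i) => [j|] ->.
  have -> : rV_cons (x, v) ord0 (lift ord0 j) = v ord0 j; last exact: H2.
  rewrite (_ : lift ord0 j = rshift 1 j :> 'I_(1 + n)); last exact: val_inj.
  exact: row_mxEr.
have -> : rV_cons (x, v) ord0 ord0 = x; last exact: H1.
rewrite (_ : ord0 = lshift n (ord0 : 'I_1)); last exact: val_inj.
by rewrite [LHS]row_mxEl mxE eqxx mulr1n.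
Qed.
End lebesgue_rV.

Definition mxdot (R : realType) m n (A B : 'M[R]_(m, n)) : R :=
  \sum_i \sum_j A i j * B i j.

Section sobolev.
Variables (R : realType) (d : nat).
Local Notation point := 'rV[R]_d.
Local Notation mu := (lebesgue_rV R d).
Implicit Types (D : set point) (w : point -> point).

Definition smooth (phi : point -> R) : Prop :=
  forall (vs : seq point) (s : point),
    differentiable (foldr (fun v f => 'D_v f) phi vs) s.

Definition test_function D (phi : point -> R) : Prop :=
  smooth phi /\
  exists K : set point,
    [/\ compact K, K `<=` D & forall s, ~ K s -> phi s = 0].

Definition L2 D (f : point -> R) : Prop :=
  measurable_fun D f /\ mu.-integrable D (EFin \o (fun s => f s ^+ 2)).

Definition Linfty D (f : point -> R) : Prop :=
  measurable_fun D f /\ exists C : R, {ae mu, forall s, D s -> `|f s| <= C}.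

(* G s i j is the weak derivative of the i-th component of w with respect to
   the j-th coordinate. *)
Definition weak_gradient D w (G : point -> 'M[R]_d) : Prop :=
  forall phi, test_function D phi -> forall i j : 'I_d,
    \int[mu]_(s in D) (w s ord0 i * 'D_(delta_mx ord0 j) phi s) =
    - \int[mu]_(s in D) (G s i j * phi s).

Definition H1 D w : Prop :=
  (forall i, L2 D (fun s => w s ord0 i)) /\
  exists2 G, weak_gradient D w G & forall i j, L2 D (fun s => G s i j).

(* The fields used below are continuous on closure Omega, so that their trace
   is their restriction to the boundary. *)
Definition velocity_space (Omega GammaD : set point) (ug : point -> point) u :
    Prop :=
  H1 Omega u /\ forall s, GammaD s -> u s = ug s.

Definition displacement_space B w : Prop :=
  (forall i, L2 B (fun s => w s ord0 i)) /\
  exists2 G, weak_gradient B w G & forall i j, Linfty B (fun s => G s i j).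

End sobolev.

Section finite_elements.
Variables (R : realType) (d : nat).
Local Notation point := 'rV[R]_d.
Local Notation mu := (lebesgue_rV R d).

(* The cells are open and cover D up to a null set (the skeleton of the mesh). *)
Definition mesh (D : set point) N (K : 'I_N -> set point) : Prop :=
  [/\ forall k, open (K k), forall k, K k `<=` D,
      trivIset setT K & mu.-negligible (D `\` \bigcup_k K k)].

Definition polynomial_on (K : set point) (w : point -> point) : Prop :=
  forall i : 'I_d, exists p : mpoly.mpoly d R,
    forall s, K s -> w s ord0 i = mpoly.meval (fun l => s ord0 l) p.

Definition fe_comb N (b : 'I_N -> point -> point) (c : 'cV[R]_N) (s : point) :
    point :=
  \sum_j c j ord0 *: b j s.

Definition fe_basis (D : set point) N (b : 'I_N -> point -> point) : Prop :=
  [/\ forall j, {within closure D, continuous (b j)},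
      exists M (K : 'I_M -> set point),
        mesh D K /\ forall j k, polynomial_on (K k) (b j)
    & forall c, (forall s, D s -> fe_comb b c s = 0) -> c = 0].

End finite_elements.

Section elasticity.
Variables (R : realType) (d : nat).
Local Notation point := 'rV[R]_d.
Local Notation mu := (lebesgue_rV R d).

(* (grad w s) i j is the derivative of the i-th component of w with respect to
   the j-th coordinate; the Jacobian matrix of the library acts on row vectors
   from the right, hence the transposition. A continuous piecewise polynomial
   field is differentiable in every cell of its mesh, and there its weak
   gradient is almost everywhere equal to grad. *)
Definition grad (w : point -> point) (s : point) : 'M[R]_d := ('J w s)^T.

Definition defgrad (w : point -> point) (s : point) : 'M[R]_d :=
  1%:M + grad w s.

Definition dW (W : 'M[R]_d -> R) (F : 'M[R]_d) : 'M[R]_d :=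
  \matrix_(i, j) 'D_(delta_mx i j) W F.

Definition C1_posdet (W : 'M[R]_d -> R) : Prop :=
  forall F : 'M[R]_d, 0 < \det F ->
    differentiable W F /\ {for F, continuous (dW W)}.

(* The tensors with positive determinant do not form a convex set: convexity is
   required along the segments contained in that set. *)
Definition convex_posdet (W : 'M[R]_d -> R) : Prop :=
  forall F G : 'M[R]_d,
    (forall l : R, 0 <= l <= 1 -> 0 < \det (l *: F + (1 - l) *: G)) ->
    forall l : R, 0 <= l <= 1 ->
      W (l *: F + (1 - l) *: G) <= l * W F + (1 - l) * W G.

Definition piola (W : 'M[R]_d -> R) (w : point -> point) (s : point) :
    'M[R]_d :=
  dW W (defgrad w s).

Definition elastic_op (W : 'M[R]_d -> R) (B : set point)
    (w y : point -> point) : R :=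
  \int[mu]_(s in B) mxdot (piola W w s) (grad y s).

Definition elastic_vec (W : 'M[R]_d -> R) (B : set point) NY
    (y : 'I_NY -> point -> point) (w : 'cV[R]_NY) : 'cV[R]_NY :=
  \col_i elastic_op W B (fe_comb y w) (y i).

Definition elastic_energy (W : 'M[R]_d -> R) (B : set point)
    (w : point -> point) : R :=
  \int[mu]_(s in B) W (defgrad w s).

Definition Mgamma3 (PhiB : R) (B : set point) NY
    (y : 'I_NY -> point -> point) : 'M[R]_NY :=
  \matrix_(i, j) (PhiB * \int[mu]_(s in B) mxdot (y j s) (y i s)).

Definition Mgamma1 (PhiB : R) (B : set point) NV NY
    (v : 'I_NV -> point -> point) (y : 'I_NY -> point -> point)
    (h : 'cV[R]_NY) : 'M[R]_(NY, NV) :=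
  \matrix_(i, j)
    (PhiB * \int[mu]_(s in B) mxdot (v j (s + fe_comb y h s)) (y i s)).

Definition Salphagamma (PhiB : R) (B : set point) NV NY
    (v : 'I_NV -> point -> point) (y : 'I_NY -> point -> point)
    (h : 'cV[R]_NY) : 'M[R]_(NV, NY) :=
  (Mgamma1 PhiB B v y h)^T *m invmx (Mgamma3 PhiB B y).

End elasticity.

(* Main.v *)
(* The mass matrix [Mgamma3] is symmetric and, the basis being free and
   continuous, invertible; with the coupling, the left-hand side becomes the
   product of [elastic_vec] with [w'], whatever the transfer matrix [Mgamma1].
   It remains to differentiate the energy under the integral sign with respect
   to the coefficients. In the cells the fields are polynomial, so almost
   everywhere the deformation gradient is affine in the coefficients with
   bounded coefficients and lies in the compact set of bounded matrices with
   determinant at least [Jm]. There [W] is uniformly differentiable, hence its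
   integral over the bounded set [B] is differentiable. The null set left out
   requires some care because the integrand need not be measurable on it. *)

From HB Require Import structures.
Require Import Defs.
From mathcomp Require Import all_boot all_order all_algebra.
From mathcomp Require Import all_classical all_reals all_analysis.
From mathcomp Require Import measurable_realfun.
From mathcomp Require mpoly.
Import Order.TTheory GRing.Theory Num.Theory.
Import numFieldNormedType.Exports.
Import HBNNSimple.

Set Implicit Arguments.
Unset Strict Implicit.
Unset Printing Implicit Defensive.

Local Open Scope classical_set_scope.
Local Open Scope ring_scope.

(** * Matrices entry by entry: norm and limits *)

Lemma le_mx_norm (K : realDomainType) (m n : nat) (M : 'M[K]_(m, n)) i j :
  `|M i j| <= `|M|.
Proof.
by rewrite [leRHS]/Num.norm /= mx_normrE; apply: (le_bigmax _ _ (i, j)).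
Qed.

Lemma mx_norm_le (K : realDomainType) (m n : nat) (M : 'M[K]_(m, n)) (c : K) :
  0 <= c -> (forall i j, `|M i j| <= c) -> `|M| <= c.
Proof.
by move=> c0 Mc; rewrite [leLHS]/Num.norm /= mx_normrE; apply: bigmax_le.
Qed.

Lemma cvg_mx (K : numFieldType) (T : Type) (m n : nat) (F : set_system T)
    (f : T -> 'M[K]_(m, n)) (M : 'M[K]_(m, n)) :
  Filter F -> (forall i j, f x i j @[x --> F] --> M i j) -> f @ F --> M.
Proof.
move=> FF fM A [P HP PA].
have H : F [set x | forall k : 'I_m * 'I_n, P k.1 k.2 (f x k.1 k.2)].
  by apply: (@filter_forall _ _ _ F) => k; exact: fM (HP k.1 k.2).
by apply: (@filterS _ F FF _ (f @^-1` A) _ H) => x Hx; apply: PA => i j; exact: (Hx (i, j)).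
Qed.

(** * Lebesgue measure on ['rV[R]_n] and integrals up to null sets *)

Lemma measurable_rV_box (R : realType) (n : nat) (A : 'I_n -> set R) :
  (forall i, measurable (A i)) ->
  measurable [set v : 'rV[R]_n | forall i, A i (v ord0 i)].
Proof.
move=> mA.
rewrite (_ : [set _ | _] = \bigcap_(i in [set: 'I_n])
    ((fun v : 'rV[R]_n => v ord0 i) @^-1` A i)); last first.
  by apply/seteqP; split=> v vA i; [move=> _|]; exact: vA.
apply: fin_bigcap_measurable => // i _.
by rewrite -[X in measurable X]setTI; exact: measurable_mx_entry.
Qed.

(** There are countably many boxes with rational corners, and every point of an open set lies in one
    contained in that set. *)
Lemma open_rV_measurable (R : realType) (n : nat) (U : set 'rV[R]_n) :
  open U -> measurable U.
Proof.
move=> Uo.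
pose box (ab : 'rV[rat]_n * 'rV[rat]_n) := [set v : 'rV[R]_n | forall i,
  `]ratr (ab.1 ord0 i), ratr (ab.2 ord0 i)[%classic (v ord0 i)].
(* The inclusion [box ab] in [U] is part of the set, so that the union runs over all pairs of
   rational vectors, a countable type; the other boxes contribute [set0]. *)
have -> : U = \bigcup_ab [set v | box ab `<=` U /\ box ab v].
  apply/seteqP; split=> [s Us|s [ab _ [abU abs]]]; last exact: abU.
  move: Uo; rewrite openE => /(_ _ Us) /nbhs_ballP[e /= e0 eU].
  have /choice[a Ha] i : exists q : rat, ratr q \in `](s ord0 i - e), (s ord0 i)[.
    by apply: rat_in_itvoo; rewrite ltrBlDr ltrDl.
  have /choice[b Hb] i : exists q : rat, ratr q \in `](s ord0 i), (s ord0 i + e)[.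
    by apply: rat_in_itvoo; rewrite ltrDl.
  exists (\row_i a i, \row_i b i) => //; split=> [v vab|i] /=; last first.
    rewrite !mxE in_itv /=; move: (Ha i) (Hb i); rewrite !in_itv /=.
    by move=> /andP[_ ->] /andP[-> _].
  apply: eU; split=> // i j; rewrite (ord1 i) -ball_normE /=.
  have := vab j; rewrite /= !mxE in_itv /= => /andP[v1 v2].
  move: (Ha j) (Hb j); rewrite !in_itv /= => /andP[a1 a2] /andP[b1 b2].
  rewrite ltr_norml; apply/andP; split.
    by rewrite ltrBrDr addrC ltrBlDr; apply: (lt_trans v2).
  by rewrite ltrBlDr addrC -ltrBlDr; apply: (lt_trans a1).
apply: countable_bigcupT_measurable => [|ab]; first exact: countableP.
have [abU|abU] := pselect (box ab `<=` U); last first.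
  by rewrite (_ : [set _ | _] = set0) //; apply/seteqP; split=> // v [].
rewrite (_ : [set _ | _] = box ab); last first.
  by apply/seteqP; split=> // v [].
apply: (measurable_rV_box (A := fun i =>
  `]ratr (ab.1 ord0 i), ratr (ab.2 ord0 i)[%classic)) => i.
exact: measurable_itv.
Qed.

Lemma open_continuous_rV_measurable_fun (R : realType) (n : nat)
    (U : set 'rV[R]_n) (f : 'rV[R]_n -> R) :
  open U -> {in U, continuous f} -> measurable_fun U f.
Proof.
move=> Uo cf; apply: (measurability _ (RGenOpens.measurableE R)).
move=> _ [_ [a [b ->] <-]]; apply: open_rV_measurable.
rewrite openE => s [Us fs]; apply: filterI; first exact: open_nbhs_nbhs.
apply: (cf s (mem_set Us)); exact: (open_nbhs_nbhs (conj (interval_open _ _) fs)).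
Qed.

Lemma bounded_rV_measure (R : realType) (n : nat) (B : set 'rV[R]_n) :
  measurable B -> bounded_set B -> (lebesgue_rV R n B < +oo)%E.
Proof.
move=> mB [M [_ MB]].
pose A (i : 'I_n) := `[- (M + 1), M + 1]%classic.
have mA i : measurable (A i) by exact: measurable_itv.
have BA : B `<=` [set v : 'rV[R]_n | forall i, A i (v ord0 i)].
  move=> s Bs i; rewrite /A /= in_itv /= -ler_norml.
  have := MB _ (ltr_pwDr ltr01 (lexx M)) _ Bs; apply: le_trans.
  exact: le_mx_norm.
apply: (@le_lt_trans _ _ (lebesgue_rV R n [set v : 'rV[R]_n | forall i, A i (v ord0 i)])).
  by apply: le_measure; rewrite ?inE//; exact: measurable_rV_box.
rewrite lebesgue_rV_box//; rewrite ltey_eq; apply/orP; left.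
apply: (big_ind (fun x : \bar R => x \is a fin_num)) => // [x y|i _].
  exact: fin_numM.
by rewrite lebesgue_measure_itv /=; case: ifP.
Qed.

(** A ball of the max norm is a cube, whose measure is a product of positive lengths. *)
Lemma open_rV_measure_gt0 (R : realType) (n : nat) (U : set 'rV[R]_n) :
  open U -> U !=set0 -> (0 < lebesgue_rV R n U)%E.
Proof.
move=> Uo [s Us].
move: (Uo); rewrite openE => /(_ _ Us) /nbhs_ballP[e /= e0 eU].
pose A (i : 'I_n) := `](s ord0 i - e), (s ord0 i + e)[%classic.
have mA i : measurable (A i) by exact: measurable_itv.
have AU : [set v : 'rV[R]_n | forall i, A i (v ord0 i)] `<=` U.
  move=> v Av; apply: eU; split=> // i j; rewrite (ord1 i).
  have := Av j; rewrite /A /= in_itv /= => /andP[v1 v2].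
  rewrite -ball_normE /= distrC ltr_norml ltrBlDl v2 andbT.
  by rewrite ltrBrDl.
apply: (@lt_le_trans _ _ (lebesgue_rV R n [set v : 'rV[R]_n | forall i, A i (v ord0 i)])).
  rewrite lebesgue_rV_box//; apply: (big_ind (fun x : \bar R => 0 < x)%E) => // [x y|i _].
    exact: mule_gt0.
  rewrite lebesgue_measure_itv /= lte_fin.
  have se : s ord0 i - e < s ord0 i + e by rewrite ltrD2l gtrN.
  by rewrite se -EFinB lte_fin subr_gt0.
by apply: le_measure; rewrite ?inE//; [exact: measurable_rV_box|
  exact: open_rV_measurable].
Qed.

(* Unlike the lemmas of the library, this does not require [f] to be
   measurable: a simple function below [f] keeps its integral when it is
   replaced by 0 on [N]. *)
Lemma ge0_integral_setC_null (d : measure_display) (T : measurableType d)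
    (R : realType) (mu : {measure set T -> \bar R}) (N : set T)
    (f : T -> \bar R) :
  measurable N -> mu N = 0%E -> (forall x, 0 <= f x)%E ->
  (\int[mu]_x f x = \int[mu]_(x in ~` N) f x)%E.
Proof.
move=> mN N0 f0; rewrite [RHS]integral_mkcond.
have fN0 x : (0 <= (f \_ (~` N)) x)%E by exact: erestrict_ge0.
rewrite ge0_integralTE// [RHS]ge0_integralTE//.
apply/eqP; rewrite eq_le; apply/andP; split; apply: ge_ereal_sup => _ [h /= hf <-].
  apply: ereal_sup_ubound; exists (proj_nnsfun h (measurableC mN)).
    move=> x /=; rewrite /patch; case: ifPn => xN.
      by rewrite mindicE xN mulr1; exact: hf.
    by rewrite mindicE (negbTE xN) mulr0.
  rewrite -(mrestrict h (measurableC mN)) -integral_nnsfun; last first.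
    exact: measurableC.
  rewrite -integralT_nnsfun (@ge0_negligible_integral _ _ _ mu setT N) ?setTD//.
    exact/measurable_EFinP/measurable_funPT.
  by move=> x _; rewrite lee_fin.
apply: ereal_sup_ubound; exists h => // x; apply: le_trans (hf x) _.
by rewrite /patch; case: ifPn.
Qed.

(** The positive and negative parts are treated separately: extended by 0, the integrands over [B]
    and over [D] coincide outside the null set [N], which [ge0_integral_setC_null] removes. *)
Lemma Rintegral_subset_null (d : measure_display) (T : measurableType d)
    (R : realType) (mu : {measure set T -> \bar R}) (D B : set T) (f : T -> R) :
  D `<=` B -> mu.-negligible (B `\` D) ->
  \int[mu]_(x in B) f x = \int[mu]_(x in D) f x.
Proof.
move=> DB [N [mN N0 BDN]]; rewrite /Rintegral; congr fine.
have key (g : T -> \bar R) : (forall x, 0 <= g x)%E ->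
    (\int[mu]_(x in B) g x = \int[mu]_(x in D) g x)%E.
  move=> g0; rewrite integral_mkcond [RHS]integral_mkcond.
  have gr A x : (0 <= (g \_ A) x)%E by exact: erestrict_ge0.
  rewrite (ge0_integral_setC_null mN N0)// [RHS](ge0_integral_setC_null mN N0)//.
  apply: eq_integral => x; rewrite inE /patch => Nx.
  case: ifPn => [|xB]; rewrite ?inE; last first.
    by rewrite ifF//; apply: contraNF xB; rewrite !inE; exact: DB.
  move=> Bx; rewrite ifT// inE; apply: contrapT => Dx.
  by apply: Nx; exact: BDN.
by rewrite integralE [RHS]integralE !key.
Qed.

(** * Differentials, and polynomials as functions of class C1 *)

(** Bridge from explicit epsilon estimates to the little-o expansion that characterizes the
    differential. *)
Lemma is_diff_eps (R : numFieldType) (V W : normedModType R) (f : V -> W)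
    (L : {linear V -> W}) (x : V) :
  continuous L ->
  (forall e, 0 < e -> \forall h \near 0, `|f (h + x) - f x - L h| <= e * `|h|) ->
  is_diff x f L.
Proof.
move=> cL fL.
have E : f \o shift x = cst (f x) + L +o_ 0 id.
  apply/eqaddoP => e e0; have := fL e e0; apply: filterS => h /=.
  by rewrite opprD addrA.
have dE : 'd f x = L :> (V -> W) by exact: diff_unique.
apply: DiffDef => //; apply/diff_locallyP; rewrite dE; split=> //.
Qed.

(** Serves to transfer differentiability from a polynomial to a field that agrees with it only in an
    open cell. *)
Lemma near_eq_is_diff (R : numFieldType) (V W : normedModType R) (f g : V -> W)
    (x : V) :
  (\forall z \near x, f z = g z) -> differentiable g x -> is_diff x f ('d g x).
Proof.
move=> fg dg; apply: is_diff_eps => [|e e0]; first exact: diff_continuous.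
move: (dg) => /diff_locally /eqaddoP /(_ _ e0) H.
have fg' : \forall h \near (0 : V), f (h + x) = g (h + x).
  by move: fg; rewrite (near_shift 0 x); apply: filterS => h /=; rewrite subr0.
apply: filterS2 fg' H => h -> /=.
by rewrite (nbhs_singleton fg) opprD addrA.
Qed.

Lemma differentiable_rV (R : numFieldType) (V : normedModType R) (n : nat)
    (f : V -> 'rV[R]_n) (x : V) :
  (forall i, differentiable (fun s => f s ord0 i) x) -> differentiable f x.
Proof.
move=> df.
have -> : f = \sum_(i < n) (fun s => f s ord0 i *: (delta_mx ord0 i : 'rV[R]_n)).
  apply/funext => s; rewrite fct_sumE [LHS]row_sum_delta.
  by [].
apply: differentiable_sum => i.
exact: differentiableZl.
Qed.

(** Continuity is asked of each directional derivative, a real-valued function, so that stability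
    under sums and products is the sum and Leibniz rules. *)
Definition C1_fun (R : realType) (V : normedModType R) (f : V -> R) : Prop :=
  (forall s, differentiable f s) /\ forall v, continuous (fun s => 'D_v f s).

Lemma C1_cst (R : realType) (V : normedModType R) (a : R) :
  C1_fun (cst a : V -> R).
Proof.
split=> [s|v]; first exact: differentiable_cst.
by rewrite (_ : (fun _ => _) = cst 0) => [s|]; [exact: cvg_cst|
  apply/funext => s; exact: derive_cst].
Qed.

Lemma C1_D (R : realType) (V : normedModType R) (f g : V -> R) :
  C1_fun f -> C1_fun g -> C1_fun (fun s => f s + g s).
Proof.
move=> [df cf] [dg cg]; split=> [s|v]; first exact: differentiableD.
have -> : (fun s => 'D_v (fun s => f s + g s) s) =
    (fun s => 'D_v f s + 'D_v g s).
  by apply/funext => s; rewrite -deriveD//; exact: diff_derivable.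
by move=> s; apply: cvgD; [exact: cf|exact: cg].
Qed.

Lemma C1_M (R : realType) (V : normedModType R) (f g : V -> R) :
  C1_fun f -> C1_fun g -> C1_fun (fun s => f s * g s).
Proof.
move=> [df cf] [dg cg]; split=> [s|v]; first exact: differentiableM.
have -> : (fun s => 'D_v (fun s => f s * g s) s) =
    (fun s => f s * 'D_v g s + g s * 'D_v f s).
  apply/funext => s; rewrite -[LHS]/('D_v (f * g) s) deriveM//.
    exact: diff_derivable.
  exact: diff_derivable.
move=> s; apply: cvgD; apply: cvgM.
- exact: (differentiable_continuous (df s)).
- exact: (cg v s).
- exact: (differentiable_continuous (dg s)).
- exact: (cf v s).
Qed.

Lemma C1_coord (R : realType) (n : nat) (i : 'I_n) :
  C1_fun (fun s : 'rV[R]_n => s ord0 i).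
Proof.
split=> [s|v]; first exact: differentiable_coord.
have -> : (fun s => 'D_v (fun s : 'rV[R]_n => s ord0 i) s) = cst (v ord0 i).
  apply/funext => s.
  have dv : derivable (id : 'rV[R]_n -> 'rV[R]_n) s v by exact: derivable_id.
  have := derive_mx dv.
  by rewrite derive_id => /matrixP/(_ ord0 i); rewrite mxE.
by move=> s; apply: cst_continuous.
Qed.

(** Three nested inductions: on the monomials, on the variables of a monomial, on the exponent of a
    variable. *)
Lemma C1_meval (R : realType) (n : nat) (p : mpoly.mpoly n R) :
  C1_fun (fun s : 'rV[R]_n => mpoly.meval (fun l => s ord0 l) p).
Proof.
rewrite (_ : (fun _ => _) = fun s : 'rV[R]_n => \sum_(m <- mpoly.msupp p)
    mpoly.mcoeff m p * \prod_i s ord0 i ^+ mpoly.fun_of_multinom m i); last first.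
  by apply/funext => s; rewrite mpoly.mevalE.
elim: (mpoly.msupp p : seq _) => [|m r IH].
  by under [X in C1_fun X]eq_fun do rewrite big_nil; exact: C1_cst.
under [X in C1_fun X]eq_fun do rewrite big_cons.
apply: C1_D IH; apply: C1_M; first exact: C1_cst.
elim: (index_enum _) => [|i r' IH].
  by under [X in C1_fun X]eq_fun do rewrite big_nil; exact: C1_cst.
under [X in C1_fun X]eq_fun do rewrite big_cons.
apply: C1_M IH; elim: (mpoly.fun_of_multinom m i) => [|k IH].
  by under [X in C1_fun X]eq_fun do rewrite expr0; exact: C1_cst.
by under [X in C1_fun X]eq_fun do rewrite exprS; apply: C1_M => //; exact: C1_coord.
Qed.

(** * Gradients of piecewise polynomial fields *)

Lemma gradE (R : realType) (d : nat) (w : 'rV[R]_d -> 'rV[R]_d) (s : 'rV[R]_d) i l :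
  differentiable w s -> grad w s i l = ('D_(delta_mx ord0 l) w s) ord0 i.
Proof. by move=> dw; rewrite mxE mxE -deriveE. Qed.

(** The functions [D] are derivatives of the polynomials, hence continuous on the whole space and
    not only in [K]; this bounds the gradient up to the boundary of the cell. *)
Lemma polynomial_on_grad (R : realType) (d : nat) (K : set 'rV[R]_d)
    (w : 'rV[R]_d -> 'rV[R]_d) :
  open K -> polynomial_on K w ->
  exists D : 'I_d -> 'I_d -> 'rV[R]_d -> R,
    (forall i l, continuous (D i l)) /\
    forall s, K s -> differentiable w s /\ forall i l, grad w s i l = D i l s.
Proof.
move=> Ko /choice[p Hp].
pose q i (s : 'rV[R]_d) := mpoly.meval (fun l => s ord0 l) (p i).
exists (fun i l s => 'D_(delta_mx ord0 l) (q i) s); split=> [i l|s Ks].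
  exact: (C1_meval (p i)).2.
have wq i : \forall z \near s, w z ord0 i = q i z.
  have : \forall z \near s, K z by exact: open_nbhs_nbhs.
  by apply: filterS => z; exact: Hp.
have dw : differentiable w s.
  apply: differentiable_rV => i.
  exact: (ex_diff (is_diff_def := near_eq_is_diff (wq i) ((C1_meval (p i)).1 s))).
split=> // i l; rewrite gradE// derive_mx ?mxE; last exact: diff_derivable.
exact: near_eq_derive.
Qed.

Lemma bounded_rV_sub_compact (R : realType) (n : nat) (B : set 'rV[R]_n) :
  bounded_set B -> exists2 K, compact K & B `<=` K.
Proof.
move=> [M [_ MB]].
exists [set v : 'rV[R]_n | forall i, `[- (M + 1), M + 1]%classic (v ord0 i)].
  by apply: (rV_compact (A := fun=> _)) => _; exact: segment_compact.
move=> s Bs i /=; rewrite in_itv /= -ler_norml.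
apply: le_trans (MB _ (ltr_pwDr ltr01 (lexx M)) _ Bs).
exact: le_mx_norm.
Qed.

Lemma continuous_bounded (R : realType) (n : nat) (B : set 'rV[R]_n)
    (f : 'rV[R]_n -> R) :
  bounded_set B -> continuous f -> exists2 C, 0 <= C & forall s, B s -> `|f s| <= C.
Proof.
move=> /bounded_rV_sub_compact[K cK BK] cf.
have /compact_bounded[M [_ fM]] : compact (f @` K).
  by apply: continuous_compact => //; exact: continuous_subspaceT.
exists (`|M| + 1) => [|s Bs]; first by rewrite addr_ge0.
apply: fM; first by rewrite ltr_pwDr// ler_norm.
by exists s => //; exact: BK.
Qed.

(* [Q] is the complement of the skeleton of the mesh. *)
Lemma fe_basis_grad (R : realType) (d : nat) (B : set 'rV[R]_d) (N : nat)
    (y : 'I_N -> 'rV[R]_d -> 'rV[R]_d) :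
  bounded_set B -> fe_basis B y ->
  exists Q, [/\ open Q, Q `<=` B, (lebesgue_rV R d).-negligible (B `\` Q),
    forall j s, Q s -> differentiable (y j) s &
    (forall j i l, {in Q, continuous (fun s => grad (y j) s i l)}) /\
    exists2 C, 0 <= C & forall j i l s, Q s -> `|grad (y j) s i l| <= C].
Proof.
move=> Bb [_ [M [K [[Ko KB _ BK] yK]]] _].
exists (\bigcup_k K k); split => //.
- exact: bigcup_open.
- by move=> s [k _]; exact: KB.
- by move=> j s [k _ Ks]; have [D [_ /(_ _ Ks)[]]] := polynomial_on_grad (Ko k) (yK j k).
- have /choice[D HD] (jk : 'I_N * 'I_M) : exists D : 'I_d -> 'I_d -> 'rV[R]_d -> R,
      (forall i l, continuous (D i l)) /\
      forall s, K jk.2 s ->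
        differentiable (y jk.1) s /\ forall i l, grad (y jk.1) s i l = D i l s.
    exact: polynomial_on_grad.
  split=> [j i l s|].
    rewrite inE => -[k _ Ks]; have [cD Dg] := HD (j, k).
    have : {near s, D (j, k) i l =1 (fun z => grad (y j) z i l)}.
      have : \forall z \near s, K k z by exact: open_nbhs_nbhs.
      by apply: filterS => z /Dg[_ /(_ i l)].
    move=> /near_eq_cvg gD; apply: cvg_trans gD _.
    by rewrite (Dg _ Ks).2; exact: cD.
  have /choice[C HC] (x : 'I_N * 'I_M * ('I_d * 'I_d)) : exists C, 0 <= C /\
      forall s, B s -> `|D x.1 x.2.1 x.2.2 s| <= C.
    have [C C0 HC] := continuous_bounded Bb ((HD x.1).1 x.2.1 x.2.2).
    by exists C.
  (* All the bounds are nonnegative, so their sum over fields, cells and entries dominates each of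
     them. *)
  exists (\sum_x C x) => [|j i l s [k _ Ks]].
    by apply: sumr_ge0 => x _; exact: (HC x).1.
  rewrite ((HD (j, k)).2 _ Ks).2 (bigD1 ((j, k), (i, l)))//=.
  rewrite (le_trans ((HC ((j, k), (i, l))).2 _ _))//; first exact: KB Ks.
  by rewrite lerDl; apply: sumr_ge0 => x _; exact: (HC x).1.
Qed.

(** * Determinants and the Frobenius product *)

Lemma det_continuous (R : realType) (n : nat) :
  continuous (fun M : 'M[R]_n => \det M).
Proof.
rewrite /determinant.
apply: (@continuous_big R^o _ +%R 0 predT _ _ _ (fun s M => _)) => [|s _].
  exact: add_continuous.
move=> M; apply: (@cvgM _ _ (nbhs M)); first exact: cvg_cst.
apply: (@continuous_big R^o _ *%R 1 predT _ _ _ (fun s M => _)) => [|i _].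
  exact: mul_continuous.
exact: coord_continuous.
Qed.

Lemma open_posdet (R : realType) (n : nat) : open [set M : 'M[R]_n | 0 < \det M].
Proof.
rewrite (_ : [set _ | _] = (fun M : 'M[R]_n => \det M) @^-1` [set x | 0 < x]) //.
apply: open_comp; last exact: open_gt.
by move=> M _; exact: det_continuous.
Qed.

Lemma mxdotDl (R : realType) m n (A B C : 'M[R]_(m, n)) :
  mxdot (A + B) C = mxdot A C + mxdot B C.
Proof.
rewrite /mxdot -big_split; apply: eq_bigr => i _.
by rewrite -big_split; apply: eq_bigr => j _; rewrite mxE mulrDl.
Qed.

Lemma mxdotNl (R : realType) m n (A C : 'M[R]_(m, n)) :
  mxdot (- A) C = - mxdot A C.
Proof.
rewrite /mxdot -sumrN; apply: eq_bigr => i _.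
by rewrite -sumrN; apply: eq_bigr => j _; rewrite mxE mulNr.
Qed.

Lemma mxdotC (R : realType) m n (A C : 'M[R]_(m, n)) : mxdot A C = mxdot C A.
Proof.
by apply: eq_bigr => i _; apply: eq_bigr => j _; rewrite mulrC.
Qed.

Lemma mxdotDr (R : realType) m n (A B C : 'M[R]_(m, n)) :
  mxdot A (B + C) = mxdot A B + mxdot A C.
Proof. by rewrite mxdotC mxdotDl !(mxdotC A). Qed.

Lemma mxdotZr (R : realType) m n a (A C : 'M[R]_(m, n)) :
  mxdot A (a *: C) = a * mxdot A C.
Proof.
rewrite /mxdot mulr_sumr; apply: eq_bigr => i _.
by rewrite mulr_sumr; apply: eq_bigr => j _; rewrite mxE mulrCA.
Qed.

Lemma mxdot0r (R : realType) m n (A : 'M[R]_(m, n)) : mxdot A 0 = 0.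
Proof. by rewrite -[X in mxdot A X](scale0r 0) mxdotZr mul0r. Qed.

Lemma mxdot_sumr (R : realType) m n (I : Type) (r : seq I) (A : 'M[R]_(m, n))
    (F : I -> 'M[R]_(m, n)) :
  mxdot A (\sum_(i <- r) F i) = \sum_(i <- r) mxdot A (F i).
Proof. by apply: big_morph => [B C|]; [exact: mxdotDr|exact: mxdot0r]. Qed.

(** The norm is the largest absolute value of an entry, whence the factor counting the entries. *)
Lemma mxdot_le (R : realType) m n (A B : 'M[R]_(m, n)) :
  `|mxdot A B| <= (m * n)%:R * `|A| * `|B|.
Proof.
apply: le_trans (ler_norm_sum _ _ _) _.
apply: (@le_trans _ _ (\sum_(i < m) n%:R * `|A| * `|B|)); last first.
  by rewrite sumr_const card_ord -[leLHS]mulr_natl natrM !mulrA.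
apply: ler_sum => i _; apply: le_trans (ler_norm_sum _ _ _) _.
apply: (@le_trans _ _ (\sum_(j < n) `|A| * `|B|)); last first.
  by rewrite sumr_const card_ord -[leLHS]mulr_natl !mulrA.
by apply: ler_sum => j _; rewrite normrM ler_pM// le_mx_norm.
Qed.

(** * First-order expansion of the energy density, uniform on compact sets *)

(** Linearity of the differential, with [H] expanded in the basis [delta_mx i j]. *)
Lemma diff_dW (R : realType) (d : nat) (W : 'M[R]_d -> R) (F H : 'M[R]_d) :
  differentiable W F -> 'd W F H = mxdot (dW W F) H.
Proof.
move=> dF; rewrite {1}[H]matrix_sum_delta linear_sum; apply: eq_bigr => i _.
rewrite linear_sum; apply: eq_bigr => j _.
by rewrite linearZ /= mxE deriveE// mulrC.
Qed.

(* Uniformity in [F] near [F0], which the mean value theorem gives, is what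
   allows the passage to compact sets. *)
Lemma C1_posdet_strict_diff (R : realType) (d : nat) (W : 'M[R]_d -> R)
    (F0 : 'M[R]_d) (e : R) :
  C1_posdet W -> 0 < \det F0 -> 0 < e ->
  \forall F \near F0 & H \near (0 : 'M[R]_d), 0 < \det (F + H) /\
    `|W (F + H) - W F - mxdot (dW W F) H| <= e * `|H|.
Proof.
move=> W1 F0det e0.
(* The factor [(d * d).+1] absorbs the constant of [mxdot_le] and is never 0; the 2 is there because
   two values of [dW W] are compared through [dW W F0]. *)
pose e1 := e / (d * d).+1%:R / 2.
have e10 : 0 < e1 by rewrite !divr_gt0.
have [r /= r0 Hr] : exists2 r, 0 < r & forall G, `|F0 - G| < r ->
    0 < \det G /\ `|dW W F0 - dW W G| <= e1.
  have : \forall G \near F0, 0 < \det G /\ `|dW W F0 - dW W G| <= e1.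
    apply: filterI.
      exact: (open_nbhs_nbhs (conj (@open_posdet R d) F0det)).
    by have /cvgrPdist_le/(_ _ e10) := (W1 _ F0det).2.
  by move=> /nbhs_ballP[r /= r0 Hr]; exists r => // G GF; apply: Hr; rewrite -ball_normE.
have r20 : 0 < r / 2 by rewrite divr_gt0.
near=> F H.
(* With [F] within [r / 2] of [F0] and [H] of norm below [r / 2], the whole segment from [F] to
   [F + H] stays in the ball where [Hr] applies. *)
have segm (x : R) : 0 <= x <= 1 -> `|F0 - (F + x *: H)| < r.
  move=> /andP[x0 x1]; rewrite opprD addrA (splitr r).
  apply: le_lt_trans (ler_normB _ _) _; apply: ltrD.
    by near: F; apply: cvgr_dist_lt => //; exact: cvg_id.
  apply: (@le_lt_trans _ _ `|H|).
    by rewrite normrZ ger0_norm// ler_piMl.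
  by rewrite -[H]opprK normrN -sub0r; near: H; apply: cvgr_dist_lt => //; exact: cvg_id.
split.
  by rewrite -[H]scale1r; apply: (Hr _ (segm _ _)).1; rewrite ler01 lexx.
pose phi (x : R) := W (F + x *: H).
have dphi (x : R) : 0 <= x <= 1 -> is_derive x 1 phi (mxdot (dW W (F + x *: H)) H).
  move=> /segm/Hr[detx _]; have dx := (W1 _ detx).1.
  have dl : is_diff x (fun x : R => F + x *: H) (0 + *:%R^~ H).
    by apply: is_diffD.
  have dp : is_diff x phi ('d W (F + x *: H) \o (0 + *:%R^~ H)).
    by apply: (is_diff_comp dl); exact: differentiableP.
  apply: DeriveDef; first exact: diff_derivable.
  rewrite deriveE// diff_val /= -diff_dW//.
  by congr ('d W _ _); rewrite -[LHS]/(0 + 1 *: H) scale1r add0r.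
(* The mean value theorem turns the increment of [W] into [dW W] at a point of the segment, to be
   compared with [dW W F]. *)
have [c cin Hc] : exists2 c, c \in `[0, 1]%R &
    phi 1 - phi 0 = mxdot (dW W (F + c *: H)) H * (1 - 0).
  apply: MVT_segment => // [x|].
    by rewrite in_itv /= => /andP[x0 x1]; apply: dphi; rewrite !ltW.
  by apply: derivable_within_continuous => x; rewrite in_itv /= => /dphi[].
have {}Hc : W (F + H) - W F = mxdot (dW W (F + c *: H)) H.
  by move: Hc; rewrite /phi scale1r scale0r addr0 subr0 mulr1.
rewrite Hc -mxdotNl -mxdotDl; apply: le_trans (mxdot_le _ _) _.
apply: ler_wpM2r => //.
have n1 : `|dW W (F + c *: H) - dW W F| <= e1 * 2.
  rewrite -(subrKA (dW W F0)) mulr_natr mulr2n; apply: le_trans (ler_normD _ _) _.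
  apply: lerD; last first.
    rewrite -[F]addr0 -[0](scale0r H).
    by apply: (Hr _ (segm _ _)).2; rewrite lexx ler01.
  by rewrite distrC; apply: (Hr _ (segm _ _)).2; move: cin; rewrite in_itv.
apply: (@le_trans _ _ ((d * d).+1%:R * (e1 * 2))).
  by apply: ler_pM => //; rewrite ler_nat.
by rewrite /e1 divfK// mulrC divfK.
Unshelve. all: by end_near. Qed.

(** The previous estimate holds for [F] near each point of [K] and [H] near 0 jointly, so
    compactness yields one neighbourhood of 0 for all of [K]. *)
Lemma C1_posdet_compact_diff (R : realType) (d : nat) (W : 'M[R]_d -> R)
    (K : set 'M[R]_d) (e : R) :
  C1_posdet W -> compact K -> (forall F, K F -> 0 < \det F) -> 0 < e ->
  \forall H \near (0 : 'M[R]_d), forall F, K F -> 0 < \det (F + H) /\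
    `|W (F + H) - W F - mxdot (dW W F) H| <= e * `|H|.
Proof.
move=> W1 /compact_near_coveringP cK Kdet e0.
apply: (cK _ (nbhs (0 : 'M[R]_d)) (fun H F => 0 < \det (F + H) /\
    `|W (F + H) - W F - mxdot (dW W F) H| <= e * `|H|) _) => F KF.
exact: C1_posdet_strict_diff (Kdet _ KF) e0.
Qed.

(** A closed set inside the image by [vec_mx] of a compact cube of ['rV[R]_(d * d)]. *)
Lemma compact_bounded_posdet (R : realType) (d : nat) (C J : R) :
  compact [set F : 'M[R]_d | (forall i j, `|F i j| <= C) /\ J <= \det F].
Proof.
pose K := [set v : 'rV[R]_(d * d) | forall i, `[- C, C]%classic (v ord0 i)].
have cK : compact K.
  by apply: (rV_compact (A := fun=> _)) => _; exact: segment_compact.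
have vec_cts : continuous (vec_mx : 'rV[R]_(d * d) -> 'M[R]_d).
  move=> v; apply: (@cvg_mx _ _ _ _ (nbhs v)) => i j; rewrite mxE.
  by under eq_cvg do rewrite mxE; exact: coord_continuous.
have cK' := continuous_compact (continuous_subspaceT vec_cts) cK.
apply: (subclosed_compact _ cK').
  rewrite (_ : [set _ | _] = (\bigcap_(k in [set: 'I_d * 'I_d])
      (fun F : 'M[R]_d => `|F k.1 k.2|) @^-1` [set x | x <= C]) `&`
      (fun F : 'M[R]_d => \det F) @^-1` [set x | J <= x]); last first.
    apply/seteqP; split=> F [FC FJ]; split=> //=.
      by move=> k _; exact: FC.
    by move=> i j; exact: (FC (i, j) I).
  apply: closedI; last first.
    by apply: closed_comp; [move=> F _; exact: det_continuous|exact: closed_ge].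
  apply: closed_bigI => k _; apply: closed_comp; last exact: closed_le.
  by move=> F _; apply: continuous_comp; [exact: coord_continuous|exact: norm_continuous].
move=> F [FC _]; exists (mxvec F); last exact: mxvecK.
move=> k; case/mxvec_indexP: k => i j; rewrite mxvecE /= in_itv /= -ler_norml.
exact: FC.
Qed.

(** * Differentiation under the integral sign *)

Lemma mxdot_is_linear (R : realType) m n (A : 'M[R]_(m, n)) :
  linear (mxdot A : 'M[R]_(m, n) -> R).
Proof. by move=> a B C; rewrite mxdotDr mxdotZr. Qed.

Lemma mxdot_continuous (R : realType) m n (A : 'M[R]_(m, n)) :
  continuous (mxdot A).
Proof.
apply: (@continuous_big R^o _ +%R 0 predT _ _ _ (fun s M => _)) => [|i _].
  exact: add_continuous.
apply: (@continuous_big R^o _ +%R 0 predT _ _ _ (fun s M => _)) => [|j _].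
  exact: add_continuous.
move=> M; apply: (@cvgM _ _ (nbhs M)); first exact: cvg_cst.
exact: coord_continuous.
Qed.

Lemma integrable_sum_fun (d : measure_display) (T : measurableType d) (R : realType)
    (mu : {measure set T -> \bar R}) (D : set T) (I : Type) (r : seq I)
    (f : I -> T -> R) :
  measurable D -> (forall i, mu.-integrable D (EFin \o f i)) ->
  mu.-integrable D (EFin \o (fun s => \sum_(i <- r) f i s)) /\
  \int[mu]_(s in D) (\sum_(i <- r) f i s) = \sum_(i <- r) \int[mu]_(s in D) f i s.
Proof.
move=> mD intf; elim: r => [|i r [IH1 IH2]].
  rewrite big_nil; split.
    apply: eq_integrable (integrable0 _ _) => // s _ /=.
    by rewrite big_nil.
  rewrite (eq_Rintegral _ (g := cst 0)) => [|s _]; last by rewrite big_nil.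
  by rewrite Rintegral_cst// mul0r.
split.
  apply: eq_integrable (integrableD mD (intf i) IH1) => // s _ /=.
  by rewrite big_cons.
rewrite big_cons -IH2 -RintegralD//; apply: eq_Rintegral => s _.
by rewrite big_cons.
Qed.

(** The bound on the remainder is uniform in [s], so integrating it over a set of finite measure
    keeps it small with respect to [h]. *)
Lemma is_diff_Rintegral (d : measure_display) (T : measurableType d) (R : realType)
    (mu : {measure set T -> \bar R}) (D : set T) (N : nat)
    (f : 'cV[R]_N -> T -> R) (g : 'I_N -> T -> R) (c0 : 'cV[R]_N) :
  measurable D -> (mu D < +oo)%E ->
  (\forall h \near (0 : 'cV[R]_N), mu.-integrable D (EFin \o f (h + c0))) ->
  (forall j, mu.-integrable D (EFin \o g j)) ->
  (forall e, 0 < e -> \forall h \near (0 : 'cV[R]_N), forall s, D s ->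
    `|f (h + c0) s - f c0 s - \sum_j h j ord0 * g j s| <= e * `|h|) ->
  is_diff c0 (fun c => \int[mu]_(s in D) f c s)
    (mxdot (\col_j \int[mu]_(s in D) g j s)).
Proof.
move=> mD muD intf intg fg.
set A := \col_j _.
pose Lm := GRing.isLinear.Build _ _ _ _ _ (mxdot_is_linear A).
pose L : {linear 'cV[R]_N -> R} := HB.pack (mxdot A : 'cV[R]_N -> R) Lm.
apply: (@is_diff_eps _ _ _ _ L) => [|e e0]; first exact: mxdot_continuous.
pose m := fine (mu D).
have m0 : 0 <= m by exact: fine_ge0.
(* Dividing by [m + 1] rather than [m] covers the case of a null set [D]. *)
have e1 : 0 < e / (m + 1) by rewrite divr_gt0// ltr_wpDl.
have if0 : mu.-integrable D (EFin \o f c0).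
  by have := nbhs_singleton intf; rewrite add0r.
near=> h.
have ifh : mu.-integrable D (EFin \o f (h + c0)) by near: h.
have ighj j : mu.-integrable D (EFin \o (fun s => h j ord0 * g j s)).
  exact: (integrableZl mD (h j ord0) (intg j)).
have [igh Egh] := integrable_sum_fun (index_enum _) mD ighj.
have -> : L h = \int[mu]_(s in D) \sum_j h j ord0 * g j s.
  rewrite Egh /L /= /mxdot; apply: eq_bigr => j _.
  by rewrite big_ord1 mxE RintegralZl// mulrC.
have id1 := integrableB mD ifh if0.
have id2 := integrableB mD id1 igh.
rewrite -RintegralB// -RintegralB//.
apply: le_trans (le_normr_Rintegral mD id2) _.
apply: (@le_trans _ _ (\int[mu]_(s in D) (e / (m + 1) * `|h|))).
  apply: le_Rintegral => //.
  - exact: integrable_norm id2.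
  - apply: measurable_bounded_integrable => //.
    by exists `|e / (m + 1) * `|h| |; split=> // x xM s _ /=; exact: ltW.
  - by near: h; exact: fg.
rewrite Rintegral_cst// -/m mulrAC ler_wpM2r//.
by rewrite mulrAC ler_pdivrMr ?ltr_wpDl// ler_wpM2l ?ltW// ltrDl.
Unshelve. all: by end_near. Qed.

(** * Differential of the elastic energy with respect to the coefficients *)

Lemma grad_fe_comb (R : realType) (d N : nat)
    (y : 'I_N -> 'rV[R]_d -> 'rV[R]_d) (c : 'cV[R]_N) (s : 'rV[R]_d) :
  (forall j, differentiable (y j) s) ->
  grad (fe_comb y c) s = \sum_j c j ord0 *: grad (y j) s.
Proof.
move=> dy.
have E : fe_comb y c = \sum_j (c j ord0 *: y j).
  by apply/funext => z; rewrite fct_sumE.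
have dc : differentiable (fe_comb y c) s.
  by rewrite E; apply: differentiable_sum => j; apply: differentiableZ; exact: dy.
apply/matrixP => i l; rewrite gradE// E.
rewrite (derive_sum (h := fun j => c j ord0 *: y j)) => [|j]; last first.
  by apply: derivableZ; apply: diff_derivable; exact: dy.
rewrite !summxE; apply: eq_bigr => j _.
rewrite deriveZ; last by apply: diff_derivable; exact: dy.
by rewrite !mxE -gradE// !mxE.
Qed.

Lemma affine_mx_continuous (R : realType) (d N : nat) (T : topologicalType)
    (M : 'M[R]_d) (c : 'cV[R]_N) (G : 'I_N -> T -> 'M[R]_d) (s : T) :
  (forall j i l, {for s, continuous (fun z => G j z i l)}) ->
  {for s, continuous (fun z => M + \sum_j c j ord0 *: G j z)}.
Proof.
move=> cG; pose e i l z := M i l + \sum_j c j ord0 * G j z i l.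
have eE z i l : (M + \sum_j c j ord0 *: G j z) i l = e i l z.
  by rewrite mxE summxE; congr (_ + _); apply: eq_bigr => j _; rewrite mxE.
have ce i l : e i l z @[z --> s] --> e i l s.
  apply: (@cvgD _ _ _ (nbhs s)); first exact: cvg_cst.
  apply: (@cvg_big R^o _ +%R 0 predT _ _ (nbhs s) _
      (fun j z => c j ord0 * G j z i l)) => [|j _]; first exact: add_continuous.
  by apply: (@cvgM _ _ (nbhs s)); [exact: cvg_cst|exact: cG].
apply: (@cvg_mx _ _ _ _ (nbhs s)) => i l; rewrite eE.
by under eq_cvg do rewrite eE; exact: ce.
Qed.

(** The set [B] is replaced by a subset [D] of full measure on which the bounds hold everywhere;
    [key] is the uniform expansion there, and [is_diff_Rintegral] concludes. *)
Lemma elastic_energy_diff (R : realType) (d N : nat) (B : set 'rV[R]_d)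
    (y : 'I_N -> 'rV[R]_d -> 'rV[R]_d) (W : 'M[R]_d -> R) (J : R)
    (c0 : 'cV[R]_N) :
  open B -> bounded_set B -> fe_basis B y -> C1_posdet W -> 0 < J ->
  {ae lebesgue_rV R d, forall s, B s -> J <= \det (defgrad (fe_comb y c0) s)} ->
  is_diff c0 (fun c => elastic_energy W B (fe_comb y c))
    (mxdot (elastic_vec W B y c0)).
Proof.
move=> Bo Bb yB W1 J0 Jdet.
have [Q [Qo QB BQ dy [cG [C C0 HC]]]] := fe_basis_grad Bb yB.
pose F c s := defgrad (fe_comb y c) s.
have FE c s : Q s -> F c s = 1%:M + \sum_j c j ord0 *: grad (y j) s.
  by move=> Qs; congr (_ + _); apply: grad_fe_comb => j; exact: dy.
have FD h s : Q s -> F (h + c0) s = F c0 s + \sum_j h j ord0 *: grad (y j) s.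
  move=> Qs; rewrite !FE// -addrA -big_split/=; congr (_ + _).
  by apply: eq_bigr => j _; rewrite mxE scalerDl addrC.
have cF c s : Q s -> {for s, continuous (F c)}.
  move=> Qs.
  have : {near s, (fun z => 1%:M + \sum_j c j ord0 *: grad (y j) z) =1 F c}.
    have : \forall z \near s, Q z by exact: open_nbhs_nbhs.
    by apply: filterS => z Qz; rewrite FE.
  move=> /near_eq_cvg FcE; rewrite /prop_for /continuous_at FE//.
  apply: (cvg_trans FcE).
  apply: (@affine_mx_continuous R d N _ 1%:M c (fun j => grad (y j)) s) => j i l.
  by apply: cG; exact: mem_set.
(* On this open set [F c] is continuous with values in the domain of regularity of [W], which makes
   [W (F c s)] and its derivatives measurable in [s]. *)
pose U c := [set s | Q s /\ 0 < \det (F c s)].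
have Uo c : open (U c).
  rewrite openE => s [Qs Fs]; apply: filterI; first exact: open_nbhs_nbhs.
  exact: (cF c s Qs _ (open_nbhs_nbhs (conj (@open_posdet R d) Fs))).
(* [D] has full measure in [B] and does not depend on [c]: for [c] near [c0]
   the determinant stays positive on all of [D], by compactness of [K] below. *)
pose D := [set s | Q s /\ J <= \det (F c0 s)].
have mD : measurable D.
  (* [D] is closed relative to the open set [Q], hence a difference of two open sets. *)
  have Vo : open [set s | Q s /\ \det (F c0 s) < J].
    rewrite openE => s [Qs Fs]; apply: filterI; first exact: open_nbhs_nbhs.
    have : {for s, continuous (fun z => \det (F c0 z))}.
      by apply: continuous_comp; [exact: cF|exact: det_continuous].
    by move=> cdet; exact: (cdet _ (open_nbhs_nbhs (conj (@open_lt _ J) Fs))).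
  rewrite (_ : D = Q `\` [set s | Q s /\ \det (F c0 s) < J]).
    by apply: measurableD; exact: open_rV_measurable.
  apply/seteqP; split=> s [Qs Fs]; split=> //; first by case=> _; rewrite ltNge Fs.
  by rewrite leNgt; apply/negP => Fs'; exact: Fs.
have DQ s : D s -> Q s by case.
have DB : D `<=` B by move=> s /DQ; exact: QB.
(* What is left out is contained in the union of the skeleton and the null set where the determinant
   bound fails. *)
have BD : (lebesgue_rV R d).-negligible (B `\` D).
  apply: negligibleS (negligibleU BQ Jdet) => s [Bs Ds].
  have [Qs|Qs] := pselect (Q s); [right|by left].
  by move=> /= Fs; apply: Ds; split=> //; exact: Fs.
have muD : (lebesgue_rV R d D < +oo)%E.
  apply: le_lt_trans (bounded_rV_measure (open_rV_measurable Bo) Bb).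
  by apply: le_measure => //; rewrite inE//; exact: open_rV_measurable.
(* Bounds the entries of [F c0] on [D]: 1 for the identity, [C] for each gradient. *)
pose C' := 1 + \sum_j `|c0 j ord0| * C.
pose K := [set M : 'M[R]_d | (forall i l, `|M i l| <= C') /\ J <= \det M].
have cK : compact K by exact: compact_bounded_posdet.
have Kdet M : K M -> 0 < \det M by case=> _; exact: lt_le_trans.
have DK s : D s -> K (F c0 s).
  move=> [Qs Fs]; split=> // i l; rewrite FE// mxE summxE.
  apply: le_trans (ler_normD _ _) _; apply: lerD.
    by rewrite mxE; case: (i == l); rewrite ?mulr1n ?mulr0n ?normr0 ?normr1.
  apply: le_trans (ler_norm_sum _ _ _) _; apply: ler_sum => j _.
  by rewrite mxE normrM ler_wpM2l// HC.
have bD (V : 'M[R]_d -> R) : (forall M, 0 < \det M -> {for M, continuous V}) ->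
    exists M, forall s, D s -> `|V (F c0 s)| <= M.
  move=> cV; have /compact_bounded[M [Mr VM]] : compact (V @` K).
    apply: continuous_compact => //; apply: continuous_in_subspaceT => M.
    by rewrite inE => /Kdet; exact: cV.
  exists (M + 1) => s Ds; apply: VM; first by rewrite ltrDl.
  by exists (F c0 s) => //; exact: DK.
have mV (V : 'M[R]_d -> R) c : (forall M, 0 < \det M -> {for M, continuous V}) ->
    D `<=` U c -> measurable_fun D (fun s => V (F c s)).
  move=> cV DU.
  have mU : measurable (U c) by exact: (open_rV_measurable (Uo c)).
  apply: (measurable_funS mU DU).
  apply: (open_continuous_rV_measurable_fun (Uo c)) => s; rewrite inE => -[Qs Fs].
  exact: (continuous_comp (cF c s Qs) (cV _ Fs)).
have DU : D `<=` U c0 by move=> s [Qs Fs]; split=> //; exact: lt_le_trans Fs.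
have intD (f : 'rV[R]_d -> R) M : measurable_fun D f ->
    (forall s, D s -> `|f s| <= M) -> (lebesgue_rV R d).-integrable D (EFin \o f).
  move=> mf fM; apply: measurable_bounded_integrable => //.
  by exists M; split=> [|x Mx s Ds]; [exact: num_real|exact: le_trans (fM s Ds) (ltW Mx)].
pose g j s := mxdot (dW W (F c0 s)) (grad (y j) s).
(* Lipschitz constant of the deformation gradient in the coefficients, uniform in [s]; the added 1
   makes it positive, since it is divided by below. *)
have [r /= r0 HrH] : exists2 r : R, 0 < r & forall (h : 'cV[R]_N) s, Q s ->
    `|\sum_j h j ord0 *: grad (y j) s| <= r * `|h|.
  exists (N%:R * C + 1) => [|h s Qs]; first by rewrite ltr_wpDl// mulr_ge0.
  apply: (@le_trans _ _ (N%:R * C * `|h|)); last by rewrite ler_wpM2r// lerDl.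
  apply: mx_norm_le => [|i l]; first by rewrite !mulr_ge0.
  rewrite summxE; apply: le_trans (ler_norm_sum _ _ _) _.
  apply: (@le_trans _ _ (\sum_(j < N) C * `|h|)); last first.
    by rewrite sumr_const card_ord -[leLHS]mulr_natl mulrA.
  apply: ler_sum => j _; rewrite mxE normrM mulrC.
  by rewrite ler_pM// ?HC// le_mx_norm.
have gsum (h : 'cV[R]_N) s : \sum_j h j ord0 * g j s =
    mxdot (dW W (F c0 s)) (\sum_j h j ord0 *: grad (y j) s).
  by rewrite mxdot_sumr; apply: eq_bigr => j _; rewrite mxdotZr.
have key e : 0 < e -> \forall h \near (0 : 'cV[R]_N), forall s, D s ->
    0 < \det (F (h + c0) s) /\
    `|W (F (h + c0) s) - W (F c0 s) - \sum_j h j ord0 * g j s| <= e * `|h|.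
  (* The deformation gradient moves by at most [r] times the norm of [h]: precision [e / r] in [F]
     gives [e] in [h], and radius [rho / r] in [h] gives [rho] in [F]. *)
  move=> e0; have er0 : 0 < e / r by rewrite divr_gt0.
  have /nbhs_ballP[rho /= rho0 Hrho] := C1_posdet_compact_diff W1 cK Kdet er0.
  have rr0 : 0 < rho / r by rewrite divr_gt0.
  near=> h => s Ds; have Qs := DQ _ Ds.
  have Hball : ball 0 rho (\sum_j h j ord0 *: grad (y j) s).
    rewrite -ball_normE /= sub0r normrN; apply: le_lt_trans (HrH _ _ Qs) _.
    by rewrite mulrC -ltr_pdivlMr//; near: h; exact: nbhs0_lt.
  have [Fdet FW] := Hrho _ Hball _ (DK _ Ds); rewrite FD// gsum; split=> //.
  apply: le_trans FW (le_trans (ler_wpM2l (ltW er0) (HrH _ _ Qs)) _).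
  by rewrite mulrA divfK// gt_eqF.
have E1 : (fun c => elastic_energy W B (fe_comb y c)) =
    fun c => \int[lebesgue_rV R d]_(s in D) W (F c s).
  by apply/funext => c; exact: Rintegral_subset_null.
have E2 : elastic_vec W B y c0 = \col_j \int[lebesgue_rV R d]_(s in D) g j s.
  by apply/matrixP => j k; rewrite !mxE; exact: Rintegral_subset_null.
have cW M : 0 < \det M -> {for M, continuous W}.
  by move=> /W1[dW _]; exact: differentiable_continuous.
have intg j : (lebesgue_rV R d).-integrable D (EFin \o g j).
  apply: (integrable_sum_fun (index_enum _) mD _).1 => i.
  apply: (integrable_sum_fun (index_enum _) mD _).1 => l.
  have cdW M : 0 < \det M -> {for M, continuous (fun M => dW W M i l)}.
    move=> /W1[_ cM]; exact: (continuous_comp cM (@coord_continuous _ _ _ i l _)).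
  have [M HM] := bD _ cdW.
  apply: (intD _ (M * C)) => [|s Ds]; last first.
    by rewrite normrM ler_pM// ?HM// HC//; exact: DQ.
  apply: measurable_funM; first exact: (mV _ c0 cdW DU).
  apply: (measurable_funS (open_rV_measurable Qo) DQ).
  exact: (open_continuous_rV_measurable_fun Qo).
rewrite E1 E2; apply: is_diff_Rintegral => //; last first.
  move=> e e0; apply: (@filterS _ (nbhs (0 : 'cV[R]_N)) _ _ _ _ (key e e0)).
  by move=> h + s Ds => /(_ _ Ds)[].
have [M HM] := bD _ cW.
have [M' HM'] : exists M', forall s, D s -> `|dW W (F c0 s)| <= M'.
  have cdW A : 0 < \det A -> {for A, continuous (fun A => `|dW W A|)}.
    move=> /W1[_ cA]; exact: (continuous_comp cA (@norm_continuous _ _ _)).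
  by have [M' HM'] := bD _ cdW; exists M' => s /HM'; rewrite normr_id.
(* Integrability for [h] near 0 follows from [key] with [e = 1]: the positive determinant gives
   measurability, and the expansion bounds the integrand by value, linear term and remainder. *)
apply: (@filterS _ (nbhs (0 : 'cV[R]_N)) _ _ _ _ (key _ ltr01)) => h Hh.
apply: (intD _ (M + (d * d)%:R * M' * (r * `|h|) + 1 * `|h|)) => [|s Ds].
  by apply: (mV _ (h + c0) cW) => s Ds; split; [exact: DQ|exact: (Hh s Ds).1].
have abc (a b c : R) : a = b + c + (a - b - c).
  by rewrite -(addrA a) -opprD [RHS]addrC subrK.
rewrite (abc (W (F (h + c0) s)) (W (F c0 s)) (\sum_j h j ord0 * g j s)).
apply: le_trans (ler_normD _ _) _; apply: lerD; last exact: (Hh s Ds).2.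
apply: le_trans (ler_normD _ _) _; apply: lerD; first exact: HM.
rewrite gsum; apply: le_trans (mxdot_le _ _) _.
rewrite ler_pM ?mulr_ge0//; last by apply: HrH; exact: DQ.
by rewrite ler_wpM2l// HM'.
Unshelve. all: by end_near. Qed.


(** * Invertibility of the mass matrix *)

(** The product is dominated by the sum of the squares. *)
Lemma L2_mul_integrable (R : realType) (d : nat) (B : set 'rV[R]_d)
    (f g : 'rV[R]_d -> R) :
  measurable B -> L2 B f -> L2 B g ->
  (lebesgue_rV R d).-integrable B (EFin \o (fun s => f s * g s)).
Proof.
move=> mB [mf f2] [mg g2].
apply: (le_integrable mB _ _ (integrableD mB f2 g2)).
  by apply/measurable_EFinP; exact: measurable_funM.
move=> s Bs /=; rewrite lee_fin normrM [leRHS]ger0_norm; last first.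
  by rewrite addr_ge0// sqr_ge0.
rewrite -(real_normK (num_real (f s))) -(real_normK (num_real (g s))).
have [fg|/ltW gf] := leP `|f s| `|g s|.
  by rewrite ler_wpDl ?sqr_ge0// expr2 ler_wpM2r.
by rewrite ler_wpDr ?sqr_ge0// expr2 ler_wpM2l.
Qed.

Lemma mxdot_L2_integrable (R : realType) (d : nat) (B : set 'rV[R]_d)
    (f g : 'rV[R]_d -> 'rV[R]_d) :
  measurable B -> (forall i, L2 B (fun s => f s ord0 i)) ->
  (forall i, L2 B (fun s => g s ord0 i)) ->
  (lebesgue_rV R d).-integrable B (EFin \o (fun s => mxdot (f s) (g s))).
Proof.
move=> mB f2 g2.
apply: (integrable_sum_fun (index_enum _) mB _).1 => a.
apply: (integrable_sum_fun (index_enum _) mB _).1 => i.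
by rewrite (ord1 a); exact: L2_mul_integrable.
Qed.

Lemma Rintegral_mxdot_fe_comb (R : realType) (d N : nat) (B : set 'rV[R]_d)
    (y : 'I_N -> 'rV[R]_d -> 'rV[R]_d) (c : 'cV[R]_N)
    (f : 'rV[R]_d -> 'rV[R]_d) :
  measurable B -> (forall i, L2 B (fun s => f s ord0 i)) ->
  (forall j i, L2 B (fun s => y j s ord0 i)) ->
  \int[lebesgue_rV R d]_(s in B) mxdot (f s) (fe_comb y c s) =
  \sum_j c j ord0 * \int[lebesgue_rV R d]_(s in B) mxdot (f s) (y j s).
Proof.
move=> mB f2 y2.
have intj j := mxdot_L2_integrable mB f2 (y2 j).
have intcj j : (lebesgue_rV R d).-integrable B
    (EFin \o (fun s => c j ord0 * mxdot (f s) (y j s))).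
  exact: (integrableZl mB (c j ord0) (intj j)).
under eq_bigr do rewrite -RintegralZl//.
rewrite -(integrable_sum_fun _ mB intcj).2; apply: eq_Rintegral => s _.
by rewrite mxdot_sumr; apply: eq_bigr => j _; rewrite mxdotZr.
Qed.

Lemma fe_comb_continuous (R : realType) (d N : nat) (B : set 'rV[R]_d)
    (y : 'I_N -> 'rV[R]_d -> 'rV[R]_d) (c : 'cV[R]_N) i :
  open B -> (forall j, {within closure B, continuous (y j)}) ->
  {in B, continuous (fun s => fe_comb y c s ord0 i)}.
Proof.
move=> Bo cy s; rewrite inE => Bs.
have cj j : {for s, continuous (fun z => y j z ord0 i)}.
  have := continuous_subspaceW (@subset_closure _ B) (cy j).
  rewrite (continuous_open_subspace _ Bo) => /(_ s (mem_set Bs)) ys.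
  exact: (continuous_comp ys (@coord_continuous _ _ _ ord0 i _)).
have E z : fe_comb y c z ord0 i = \sum_j c j ord0 * y j z ord0 i.
  by rewrite summxE; apply: eq_bigr => j _; rewrite mxE.
rewrite /continuous_at E; under eq_cvg do rewrite E.
apply: (@cvg_big R^o _ +%R 0 predT _ _ (nbhs s) _
    (fun j z => c j ord0 * y j z ord0 i)) => [|j _]; first exact: add_continuous.
by apply: (@cvgM _ _ (nbhs s)); [exact: cvg_cst|exact: cj].
Qed.

(** By continuity the set [U] where [f] does not vanish is open; if nonempty it has positive
    measure, whereas the zero integral puts it inside a null set. *)
Lemma continuous_sqr_integral_eq0 (R : realType) (d : nat) (B : set 'rV[R]_d)
    (f : 'rV[R]_d -> R) :
  open B -> {in B, continuous f} -> L2 B f ->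
  \int[lebesgue_rV R d]_(s in B) (f s ^+ 2) = 0 -> forall s, B s -> f s = 0.
Proof.
move=> Bo cf [mf f2] f0 s0 Bs0; apply: contrapT => fs0.
have mB := open_rV_measurable Bo.
pose U := [set s | B s /\ f s != 0].
have Uo : open U.
  rewrite openE => s [Bs fs]; apply: filterI; first exact: open_nbhs_nbhs.
  exact: (cf s (mem_set Bs) _ (open_nbhs_nbhs (conj (@open_neq _ 0) fs))).
have : (0 < lebesgue_rV R d U)%E.
  by apply: open_rV_measure_gt0 => //; exists s0; split=> //; exact/eqP.
rewrite ltNge => /negP; apply.
have E0 : (\int[lebesgue_rV R d]_(s in B) `|(f s ^+ 2)%:E| = 0)%E.
  rewrite -[RHS]/(0%:E) -f0 /Rintegral fineK; last exact: integrable_fin_num.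
  by apply: eq_integral => s _; rewrite gee0_abs// lee_fin sqr_ge0.
have [N [mN N0 UN]] := (ae_eq_integral_abs _ mB (measurable_int _ f2)).1 E0.
rewrite -[leRHS]N0; apply: le_measure; rewrite ?inE//; first exact: open_rV_measurable.
move=> s [Bs fs]; apply: UN => /= /(_ Bs) [] /eqP.
by rewrite sqrf_eq0 (negbTE fs).
Qed.

Lemma trmx_Mgamma3 (R : realType) (d N : nat) (PhiB : R) (B : set 'rV[R]_d)
    (y : 'I_N -> 'rV[R]_d -> 'rV[R]_d) : (Mgamma3 PhiB B y)^T = Mgamma3 PhiB B y.
Proof.
apply/matrixP => i j; rewrite !mxE; congr (_ * _).
by apply: eq_Rintegral => s _; exact: mxdotC.
Qed.

(** Gram matrix argument: a null vector [c] gives a field orthogonal to every [y k], hence to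
    itself; being continuous it vanishes on [B], and freeness gives [c = 0]. *)
Lemma Mgamma3_unitmx (R : realType) (d N : nat) (PhiB : R) (B : set 'rV[R]_d)
    (y : 'I_N -> 'rV[R]_d -> 'rV[R]_d) :
  0 < PhiB -> open B -> fe_basis B y ->
  (forall c, displacement_space B (fe_comb y c)) -> Mgamma3 PhiB B y \in unitmx.
Proof.
move=> Phi0 Bo [cy _ yfree] yY.
have mB := open_rV_measurable Bo.
have c2 c i : L2 B (fun s => fe_comb y c s ord0 i) := (yY c).1 i.
have y2 j i : L2 B (fun s => y j s ord0 i).
  (* The regularity hypothesis concerns combinations, so the basis field is written as one. *)
  have -> : y j = fe_comb y (delta_mx j ord0).
    apply/funext => s; rewrite /fe_comb (bigD1 j)//= big1 => [|k kj].
      by rewrite mxE !eqxx scale1r addr0.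
    by rewrite mxE (negbTE kj) scale0r.
  exact: c2.
rewrite unitmxE unitfE; apply/negP => /det0P[v v0 vM].
pose c := v^T; have y_c k :
    \int[lebesgue_rV R d]_(s in B) mxdot (y k s) (fe_comb y c s) = 0.
  rewrite Rintegral_mxdot_fe_comb//.
  apply: (mulfI (lt0r_neq0 Phi0)); rewrite mulr0 mulr_sumr.
  move/matrixP: vM => /(_ ord0 k); rewrite !mxE => vMk; rewrite -[RHS]vMk.
  by apply: eq_bigr => j _; rewrite !mxE mulrCA.
have cc : \int[lebesgue_rV R d]_(s in B) mxdot (fe_comb y c s) (fe_comb y c s) = 0.
  rewrite Rintegral_mxdot_fe_comb//; apply: big1 => j _.
  rewrite (eq_Rintegral _ (g := fun s => mxdot (y j s) (fe_comb y c s))).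
    by rewrite y_c mulr0.
  by move=> s _; exact: mxdotC.
have int2 i : (lebesgue_rV R d).-integrable B
    (EFin \o (fun s => fe_comb y c s ord0 i ^+ 2)) := (c2 c i).2.
have ci i : \int[lebesgue_rV R d]_(s in B) (fe_comb y c s ord0 i ^+ 2) = 0.
  move: cc; rewrite (eq_Rintegral _ (g := fun s => \sum_i fe_comb y c s ord0 i ^+ 2)).
    rewrite (integrable_sum_fun _ mB int2).2 => /eqP; rewrite psumr_eq0.
      by move=> /allP/(_ i (mem_index_enum _))/eqP.
    by move=> j _; apply: Rintegral_ge0 => s _; exact: sqr_ge0.
  by move=> s _; rewrite /mxdot big_ord1; apply: eq_bigr => j _; rewrite expr2.
have c0 : c = 0.
  apply: yfree => s Bs; apply/rowP => i; rewrite mxE.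
  apply: (continuous_sqr_integral_eq0 Bo _ (c2 c i) (ci i) Bs).
  exact: fe_comb_continuous.
by move/eqP: v0; apply; rewrite -[v]trmxK -/c c0 trmx0.
Qed.

(** * The energy estimate *)

Lemma mxdot_cV (R : realType) (n : nat) (A C : 'cV[R]_n) :
  mxdot A C = (A^T *m C) ord0 ord0.
Proof.
by rewrite mxE; apply: eq_bigr => i _; rewrite big_ord1 mxE.
Qed.

Unset Implicit Arguments.
Set Strict Implicit.

Theorem theorem7 (R : realType) (d : nat) (d23 : d = 2%N \/ d = 3%N)
    (Omega GammaD B : set 'rV[R]_d)
    (Omega_nonempty : Omega !=set0)
    (Omega_open : open Omega) (Omega_connected : connected Omega)
    (GammaD_sub : GammaD `<=` closure Omega `\` Omega)
    (B_open : open B) (B_bounded : bounded_set B)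
    (ug : 'rV[R]_d -> 'rV[R]_d)
    (NV NY : nat)
    (v : 'I_NV -> 'rV[R]_d -> 'rV[R]_d) (y : 'I_NY -> 'rV[R]_d -> 'rV[R]_d)
    (v_basis : fe_basis Omega v) (v_H1 : forall c, H1 Omega (fe_comb v c))
    (y_basis : fe_basis B y)
    (y_sub : forall c, displacement_space B (fe_comb y c))
    (W : 'M[R]_d -> R) (W_C1 : C1_posdet W) (W_convex : convex_posdet W)
    (PhiB : R) (PhiB_gt0 : 0 < PhiB)
    (T : R) (w : R -> 'cV[R]_NY) (u : R -> 'cV[R]_NV)
    (w_derivable : forall t : R, 0 < t < T -> derivable w t 1)
    (u_sub : forall t : R, 0 < t < T ->
      velocity_space Omega GammaD ug (fe_comb v (u t)))
    (Jm : R) (Jm_gt0 : 0 < Jm)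
    (w_det : forall t : R, 0 < t < T ->
      {ae lebesgue_rV R d, forall s, B s ->
         Jm <= \det (defgrad (fe_comb y (w t)) s)})
    (w_in : forall t : R, 0 < t < T ->
      forall s, B s -> Omega (s + fe_comb y (w t) s))
    (t : R) (t_in : 0 < t < T)
    (coupling : Mgamma3 PhiB B y *m 'D_1 w t - Mgamma1 PhiB B v y (w t) *m u t
                = 0) :
  is_derive t 1 (fun tau => elastic_energy W B (fe_comb y (w tau)))
    (mxdot (Salphagamma PhiB B v y (w t) *m elastic_vec W B y (w t)) (u t)).
Proof.
have M3u : Mgamma3 PhiB B y \in unitmx by exact: Mgamma3_unitmx.
have wE : 'D_1 w t = invmx (Mgamma3 PhiB B y) *m (Mgamma1 PhiB B v y (w t) *m u t).
  by move/subr0_eq: coupling => <-; rewrite mulKmx.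
(* Transposition moves [Mgamma1] and the inverse of the symmetric [Mgamma3] onto [u t], where by
   [wE] they produce the derivative of [w]. *)
have -> : mxdot (Salphagamma PhiB B v y (w t) *m elastic_vec W B y (w t)) (u t) =
    mxdot (elastic_vec W B y (w t)) ('D_1 w t).
  by rewrite !mxdot_cV wE !trmx_mul trmxK trmx_inv trmx_Mgamma3 !mulmxA.
have dE := elastic_energy_diff B_open B_bounded y_basis W_C1 Jm_gt0 (w_det t t_in).
have dw : is_diff t w ('d w t).
  by apply: differentiableP; exact/derivable1_diffP/w_derivable.
(* Chain rule through the coefficient vector: the derivative of the energy is its differential at
   [w t] applied to the derivative of [w]. *)
have dEw := is_diff_comp dw dE.
apply: DeriveDef; first exact: (diff_derivable (ex_diff (is_diff_def := dEw))).
rewrite deriveE; last exact: (ex_diff (is_diff_def := dEw)).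
by rewrite diff_val /= deriveE.
Qed.
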